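(* Let $(M,h)$ be a closed Riemannian spin surface, let $\lambda,\kappa\in\mathbb{R}$, and let $\psi=(\psi^1,\dots,\psi^q)\in\Gamma(\Sigma M\otimes\mathbb{R}^q)$ be a solution of $$\not\partial\psi^i=\lambda\psi^i+\kappa|\psi|^2\psi^i,\qquad i=1,\dots,q.$$ Then for all $i,m\in\{1,\dots,q\}$ the Noether current $$J^{im}_\alpha:=\langle\psi^i,e_\alpha\cdot\psi^m\rangle_{\Sigma M}$$ is conserved, that is, $\nabla_{e_\alpha}J^{im}_\alpha=0$ (sum over $\alpha$; the divergence of $J^{im}$ vanishes).
   Context: $\Sigma M$ is the spinor bundle of $(M,h)$ with hermitian scalar product $\langle\cdot,\cdot\rangle_{\Sigma M}$ and metric spin connection $\nabla^{\Sigma M}$. Clifford multiplication by tangent vectors is skew-symmetric, $\langle\psi,X\cdot\eta\rangle=-\langle X\cdot\psi,\eta\rangle$, and satisfies $X\cdot Y\cdot\psi+Y\cdot X\cdot\psi=-2h(X,Y)\psi$. $(e_\alpha)$ is a local orthonormal frame of $TM$, $\not\partial=e_\alpha\cdot\nabla^{\Sigma M}_{e_\alpha}$ is the Dirac operator, and $|\psi|^2=\sum_{j=1}^q|\psi^j|^2_{\Sigma M}$. $J^{im}$ is viewed as a complex-valued one-form (vector field) on $M$ with components $J^{im}_\alpha=J^{im}(e_\alpha)$. $\Gamma$ denotes smooth sections. *)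

(* Defs.v *)
From HB Require Import structures.
From mathcomp Require Import all_boot all_order all_algebra.
From mathcomp Require Import complex ring.
From mathcomp Require Import all_classical all_reals all_analysis.

Set Implicit Arguments.
Unset Strict Implicit.
Unset Printing Implicit Defensive.

Import Order.TTheory GRing.Theory Num.Theory.
Import numFieldNormedType.Exports.

Local Open Scope classical_set_scope.
Local Open Scope ring_scope.
Local Open Scope complex_scope.

(** * Smooth real functions on open subsets of the plane *)

Fixpoint Ck (R : realType) (n : nat) (V : set 'rV[R]_2) (f : 'rV[R]_2 -> R)
    : Prop :=
  if n is n'.+1 then
    (forall x, V x -> differentiable f x) /\
    (forall v : 'rV[R]_2, Ck n' V ('D_v f))
  else forall x, V x -> {for x, continuous f}.

Definition smooth (R : realType) (V : set 'rV[R]_2) (f : 'rV[R]_2 -> R) : Prop :=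
  forall n, Ck n V f.

(** * Closed surfaces

    A closed surface is a compact Hausdorff space with a smooth atlas modelled
    on open subsets of the plane (no boundary).  Charts are partial
    homeomorphisms: [chart a] is meaningful on [chart_dom a] only,
    and [chartV a], its inverse, on the open set [chart a @` chart_dom a] only. *)

Record closedSurface (R : realType) := ClosedSurface {
  pt : topologicalType;
  atlas : Type;
  chart_dom : atlas -> set pt;
  chart : atlas -> pt -> 'rV[R]_2;
  chartV : atlas -> 'rV[R]_2 -> pt;
  pt_compact : compact [set: pt];
  pt_hausdorff : hausdorff_space pt;
  chart_cover : forall p, exists a, chart_dom a p;
  chart_dom_open : forall a, open (chart_dom a);
  chart_img_open : forall a, open (chart a @` chart_dom a);
  chartK : forall a p, chart_dom a p -> chartV a (chart a p) = p;
  chart_continuous : forall a p, chart_dom a p -> {for p, continuous (chart a)};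
  chartV_continuous : forall a x,
        (chart a @` chart_dom a) x -> {for x, continuous (chartV a)};
  transition_smooth : forall a b k,
        smooth (chart a @` (chart_dom a `&` chart_dom b))
               (fun x => chart b (chartV a x) 0 k)
}.

Arguments chart_dom {R c} _.
Arguments chart {R c} _ _.
Arguments chartV {R c} _ _.

(** Tangent vectors and vector fields are given in a chart [a] by their
    coordinates, as row vectors: [v] stands for \sum_k v_k d/dx_k. *)

Section Calculus.
Variables (R : realType) (M : closedSurface R).
Implicit Types (a b : atlas M) (p : pt M) (v : 'rV[R]_2).

Definition smoothM a (W : set (pt M)) (f : pt M -> R) : Prop :=
  smooth (chart a @` W) (f \o chartV a).

Definition smoothMC a (W : set (pt M)) (f : pt M -> R[i]) : Prop :=
  smoothM a W (fun p => complex.Re (f p)) /\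
  smoothM a W (fun p => complex.Im (f p)).

Definition dd a v (f : pt M -> R) p : R :=
  'D_v (f \o chartV a) (chart a p).

Definition ddC a v (f : pt M -> R[i]) p : R[i] :=
  dd a v (fun q => complex.Re (f q)) p +i*
  dd a v (fun q => complex.Im (f q)) p.

Definition coord_vec (k : 'I_2) : 'rV[R]_2 := delta_mx 0 k.

(* Changes coordinates of tangent vectors from [a] to [b] by
   right multiplication. *)
Definition transition_jacobian a b p : 'M[R]_2 :=
  \matrix_(k, l) dd a (coord_vec k) (fun q => chart b q 0 l) p.

End Calculus.

(** * Riemannian metrics *)

Record riemannianSurface (R : realType) := RiemannianSurface {
  surf :> closedSurface R;
  gram : atlas surf -> pt surf -> 'M[R]_2;
  gram_smooth : forall a k l, smoothM a (chart_dom a) (fun p => gram a p k l);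
  gram_sym : forall a p, chart_dom a p -> (gram a p)^T = gram a p;
  gram_posdef : forall a p (v : 'rV[R]_2), chart_dom a p -> v != 0 ->
        0 < (v *m gram a p *m v^T) 0 0;
  gram_transition : forall a b p, chart_dom a p -> chart_dom b p ->
        gram a p = transition_jacobian a b p *m gram b p
                     *m (transition_jacobian a b p)^T
}.

Arguments gram {R r} _ _.

Section LeviCivita.
Variables (R : realType) (M : riemannianSurface R).
Implicit Types (a : atlas M) (p : pt M) (v : 'rV[R]_2).

Definition metric a p (v w : 'rV[R]_2) : R := (v *m gram a p *m w^T) 0 0.

(* \Gamma^l_{k m} *)
Definition christoffel a p (k m l : 'I_2) : R :=
  2^-1 * \sum_(n < 2) invmx (gram a p) l n *
    (dd a (coord_vec R k) (fun q => gram a q m n) p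
     + dd a (coord_vec R m) (fun q => gram a q k n) p
     - dd a (coord_vec R n) (fun q => gram a q k m) p).

Definition nabla a v (Y : pt M -> 'rV[R]_2) p : 'rV[R]_2 :=
  \row_l (dd a v (fun q => Y q 0 l) p
          + \sum_(k < 2) \sum_(m < 2) christoffel a p k m l * v 0 k * Y p 0 m).

(* A (complex-valued) one-form in the chart [a], as a function of vector
   fields. *)
Definition oneform := (pt M -> 'rV[R]_2) -> pt M -> R[i].

Definition nabla_form a (X : pt M -> 'rV[R]_2) (w : oneform)
    (Y : pt M -> 'rV[R]_2) p : R[i] :=
  ddC a (X p) (w Y) p - w (fun q => nabla a (X q) Y q) p.

(* The rows of [F p] are the coordinates of e_0(p) and e_1(p). *)
Definition local_orthonormal_frame a (W : set (pt M))
    (F : pt M -> 'M[R]_2) : Prop :=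
  [/\ open W, W `<=` chart_dom a,
      forall k l, smoothM a W (fun p => F p k l) &
      forall p (k l : 'I_2), W p ->
        metric a p (row k (F p)) (row l (F p)) = (k == l)%:R].

Definition frame_vec (F : pt M -> 'M[R]_2) (al : 'I_2)
    : pt M -> 'rV[R]_2 := fun p => row al (F p).

Definition divergence a (F : pt M -> 'M[R]_2) (w : oneform) p : R[i] :=
  \sum_(al < 2) nabla_form a (frame_vec F al) w (frame_vec F al) p.

End LeviCivita.

(** * The Clifford module of the Euclidean plane and the group Spin(2) *)

Section Clifford.
Variable R : realType.

Definition gamma_mx (al : 'I_2) : 'M[R[i]]_2 :=
  if al == 0 then delta_mx 0 1 - delta_mx 1 0
  else 'i *: (delta_mx 0 1 + delta_mx 1 0).

(* Linear in the first argument. *)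
Definition herm (u v : 'cV[R[i]]_2) : R[i] :=
  \sum_(k < 2) u k 0 * (v k 0)^*.

(* Spin(2) = { c + s e_0 e_1 : c^2 + s^2 = 1 } in the Clifford algebra, seen
   through its (faithful) spinor representation. *)
Definition spin2 : set 'M[R[i]]_2 :=
  [set u | exists c s : R, c ^+ 2 + s ^+ 2 = 1 /\
     u = (c%:C)%:M + s%:C *: (gamma_mx 0 *m gamma_mx 1)].

Lemma gamma_clifford (al be : 'I_2) :
  gamma_mx al *m gamma_mx be + gamma_mx be *m gamma_mx al
    = (- 2 * (al == be)%:R)%:M.
Proof.
apply/matrixP => k l; rewrite /gamma_mx.
by case: al => [[|[|//]] ?]; case: be => [[|[|//]] ?];
   case: k => [[|[|//]] ?]; case: l => [[|[|//]] ?];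
   rewrite ?(mxE, big_ord_recl, big_ord0) /= ?(mxE, big_ord_recl, big_ord0) /=;
   apply/eqP; rewrite eq_complex /=; apply/andP; split; apply/eqP;
   rewrite /=; ring.
Qed.

Lemma herm_gamma (al : 'I_2) (u v : 'cV[R[i]]_2) :
  herm u (gamma_mx al *m v) = - herm (gamma_mx al *m u) v.
Proof.
rewrite /herm /gamma_mx.
case: al => [[|[|//]] ?];
   rewrite ?(mxE, big_ord_recl, big_ord0) /= ?(mxE, big_ord_recl, big_ord0) /=;
   case: (u _ _) => a b; case: (u _ _) => c d;
   case: (v _ _) => e f; case: (v _ _) => g h;
   apply/eqP; rewrite eq_complex /=; apply/andP; split; apply/eqP;
   rewrite /=; ring.
Qed.

End Clifford.

(** * Spin surfaces

    The spin structure is given by a cocycle with values in Spin(2) over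
    the charts, each of which carries an orthonormal frame: [spin_lift a b]
    is a lift to Spin(2), along the double covering
    Ad : Spin(2) -> SO(2), of the change of orthonormal frames.  The existence
    of the lift forces this change of frames to be in SO(2), so the frames
    orient the surface. *)

(* Clifford multiplication by the tangent vector [v], whose components in the
   orthonormal frame [E] are h(v, e_al). *)
Definition clif_frame (R : realType) (M : riemannianSurface R) (a : atlas M)
    (E : pt M -> 'M[R]_2) (p : pt M) (v : 'rV[R]_2) : 'M[R[i]]_2 :=
  \sum_(al < 2) (metric a p v (row al (E p)))%:C *: gamma_mx R al.

Record spinSurface (R : realType) := SpinSurface {
  riem :> riemannianSurface R;
  onframe : atlas riem -> pt riem -> 'M[R]_2;
  spin_lift : atlas riem -> atlas riem -> pt riem -> 'M[R[i]]_2;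
  onframe_orthonormal : forall a,
        local_orthonormal_frame a (chart_dom a) (onframe a);
  spin_lift_smooth : forall a b k l,
        smoothMC a (chart_dom a `&` chart_dom b)
          (fun p => spin_lift a b p k l);
  spin_lift_spin2 : forall a b p, chart_dom a p -> chart_dom b p ->
        spin2 (spin_lift a b p);
  spin_lift_change : forall a b p (v : 'rV[R]_2), chart_dom a p -> chart_dom b p ->
        spin_lift a b p
          *m clif_frame b (onframe b) p (v *m transition_jacobian a b p)
        = clif_frame a (onframe a) p v *m spin_lift a b p;
  spin_lift_cocycle : forall a b c p,
        chart_dom a p -> chart_dom b p -> chart_dom c p ->
        spin_lift a b p *m spin_lift b c p = spin_lift a c p
}.

Arguments onframe {R s} _ _.
Arguments spin_lift {R s} _ _ _.

Section Spinors.
Variables (R : realType) (S : spinSurface R).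
Implicit Types (a b : atlas S) (p : pt S) (v : 'rV[R]_2).

(* A spinor field is given by its components in the trivialisations of the
   spinor bundle over the charts. *)
Definition spinor := atlas S -> pt S -> 'cV[R[i]]_2.

Definition smooth_spinor (psi : spinor) : Prop :=
  (forall a k, smoothMC a (chart_dom a) (fun p => psi a p k 0)) /\
  (forall a b p, chart_dom a p -> chart_dom b p ->
     psi a p = spin_lift a b p *m psi b p).

Definition clif a p v : 'M[R[i]]_2 := clif_frame a (onframe a) p v.

(* nabla_v psi = v(psi) + 1/2 h(nabla_v e_0, e_1) e_0 . e_1 . psi *)
Definition nabla_spin a v (psi : spinor) p : 'cV[R[i]]_2 :=
  (\col_k ddC a v (fun q => psi a q k 0) p)
  + (2^-1 * metric a p (nabla a v (frame_vec (onframe a) 0) p)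
                       (frame_vec (onframe a) 1 p))%:C
      *: (gamma_mx R 0 *m gamma_mx R 1 *m psi a p).

Definition dirac_op a (psi : spinor) p : 'cV[R[i]]_2 :=
  \sum_(al < 2) clif a p (frame_vec (onframe a) al p)
                  *m nabla_spin a (frame_vec (onframe a) al p) psi p.

Definition sqnorm (q : nat) (psi : 'I_q -> spinor) a p : R[i] :=
  \sum_(j < q) herm (psi j a p) (psi j a p).

Definition nonlinear_dirac (q : nat) (lambda kappa : R)
    (psi : 'I_q -> spinor) : Prop :=
  forall (i : 'I_q) a p, chart_dom a p ->
    dirac_op a (psi i) p =
      lambda%:C *: psi i a p + (kappa%:C * sqnorm psi a p) *: psi i a p.

Definition noether_current (q : nat) (psi : 'I_q -> spinor) (i m : 'I_q) a
    : oneform S :=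
  fun X p => herm (psi i a p) (clif a p (X p) *m psi m a p).

End Spinors.

(* Main.v *)
(* In the spin frame E over the chart, the current is the one-form
   w |-> \sum_al h(w, E_al) G_al with G_al = <psi^i, gamma_al psi^m>.  By metric
   compatibility of the Levi-Civita connection its covariant derivative is
   bilinear, so its trace over the orthonormal frame F equals the trace over E.
   There the terms from nabla E_al cancel against the commutators
   [gamma_al, gamma_0 gamma_1] produced by the spin connection, which leaves
   <psi^i, D psi^m> - <D psi^i, psi^m>; this vanishes because both spinors
   satisfy D psi = c psi with the same real function c. *)
Require Import Defs.
From mathcomp Require Import all_boot all_order all_algebra.
From mathcomp Require Import complex ring.
From mathcomp Require Import all_classical all_reals all_analysis.

Set Implicit Arguments.
Unset Strict Implicit.
Unset Printing Implicit Defensive.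

Import Order.TTheory GRing.Theory Num.Theory.
Import numFieldNormedType.Exports.

Local Open Scope classical_set_scope.
Local Open Scope ring_scope.
Local Open Scope complex_scope.

Section DirectionalDerivative.
Variables (R : realType) (M : closedSurface R) (a : atlas M) (p : pt M).
Implicit Types (f g : pt M -> R) (v w : 'rV[R]_2).

Definition diff_at f : Prop := differentiable (f \o chartV a) (chart a p).

Lemma smoothM_diff_at (W : set (pt M)) f : smoothM a W f -> W p -> diff_at f.
Proof. by move=> sf Wp; apply: (sf 1%N).1; exists p. Qed.

Lemma diff_at_cst (c : R) : diff_at (fun=> c).
Proof. exact: differentiable_cst. Qed.

Lemma diff_atD f g : diff_at f -> diff_at g -> diff_at (fun q => f q + g q).
Proof. exact: differentiableD. Qed.

Lemma diff_atN f : diff_at f -> diff_at (fun q => - f q).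
Proof. exact: differentiableN. Qed.

Lemma diff_atM f g : diff_at f -> diff_at g -> diff_at (fun q => f q * g q).
Proof. exact: differentiableM. Qed.

Lemma diff_at_sum n (f : 'I_n -> pt M -> R) :
  (forall i, diff_at (f i)) -> diff_at (fun q => \sum_i f i q).
Proof.
move=> df; rewrite /diff_at.
rewrite (_ : _ \o _ = \sum_i (f i \o chartV a)); first exact: differentiable_sum.
by apply/funext => x; rewrite fct_sumE.
Qed.

Hypothesis ap : chart_dom a p.

Lemma dd_cst v (c : R) : dd a v (fun=> c) p = 0.
Proof. exact: derive_cst. Qed.

Lemma ddD v f g : diff_at f -> diff_at g ->
  dd a v (fun q => f q + g q) p = dd a v f p + dd a v g p.
Proof.
by move=> df dg; rewrite /dd -deriveD//; apply: diff_derivable.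
Qed.

Lemma ddN v f : diff_at f -> dd a v (fun q => - f q) p = - dd a v f p.
Proof. by move=> df; rewrite /dd -deriveN//; apply: diff_derivable. Qed.

Lemma ddM v f g : diff_at f -> diff_at g ->
  dd a v (fun q => f q * g q) p = dd a v f p * g p + f p * dd a v g p.
Proof.
move=> df dg; rewrite /dd.
have -> : (fun q => f q * g q) \o chartV a
  = (f \o chartV a) * (g \o chartV a) by [].
rewrite deriveM; [|exact: diff_derivable..].
by rewrite /= chartK// addrC /GRing.scale /= mulrC.
Qed.

Lemma dd_sum v n (f : 'I_n -> pt M -> R) : (forall i, diff_at (f i)) ->
  dd a v (fun q => \sum_i f i q) p = \sum_i dd a v (f i) p.
Proof.
move=> df; rewrite /dd.
rewrite (_ : _ \o _ = \sum_i (f i \o chartV a)).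
  by apply: derive_sum => i; apply: diff_derivable; apply: df.
by apply/funext => x; rewrite fct_sumE.
Qed.

Lemma ddP (c : R) v w f : diff_at f ->
  dd a (c *: v + w) f p = c * dd a v f p + dd a w f p.
Proof. by move=> df; rewrite /dd !deriveE// linearP. Qed.

Lemma dd_eq v f g : {in chart_dom a, f =1 g} -> dd a v f p = dd a v g p.
Proof.
move=> fg; apply: near_eq_derive.
have : nbhs (chart a p) (chart a @` chart_dom a).
  by apply: open_nbhs_nbhs; split; [exact: chart_img_open|exists p].
by apply: filterS => _ [q aq <-] /=; rewrite chartK// fg// inE.
Qed.

Implicit Types z : pt M -> R[i].

Definition diffC_at z : Prop :=
  diff_at (fun q => complex.Re (z q)) /\ diff_at (fun q => complex.Im (z q)).

Lemma diffC_at_cst (c : R[i]) : diffC_at (fun=> c).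
Proof. by split; apply: diff_at_cst. Qed.

Lemma diffC_at_real f : diff_at f -> diffC_at (fun q => (f q)%:C).
Proof. by move=> df; split=> //=; apply: diff_at_cst. Qed.

Lemma ReD (x y : R[i]) : complex.Re (x + y) = complex.Re x + complex.Re y.
Proof. by case: x y => ? ? []. Qed.

Lemma ImD (x y : R[i]) : complex.Im (x + y) = complex.Im x + complex.Im y.
Proof. by case: x y => ? ? []. Qed.

Lemma ReM (x y : R[i]) : complex.Re (x * y) =
  complex.Re x * complex.Re y - complex.Im x * complex.Im y.
Proof. by case: x y => ? ? []. Qed.

Lemma ImM (x y : R[i]) : complex.Im (x * y) =
  complex.Re x * complex.Im y + complex.Im x * complex.Re y.
Proof. by case: x y => ? ? []. Qed.

Lemma Reconj (x : R[i]) : complex.Re (x^*) = complex.Re x.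
Proof. by case: x. Qed.

Lemma Imconj (x : R[i]) : complex.Im (x^*) = - complex.Im x.
Proof. by case: x. Qed.

Lemma diffC_atM z1 z2 : diffC_at z1 -> diffC_at z2 ->
  diffC_at (fun q => z1 q * z2 q).
Proof.
move=> [r1 i1] [r2 i2]; split.
- under eq_fun do rewrite ReM.
  by apply: diff_atD; [|apply: diff_atN]; apply: diff_atM.
- under eq_fun do rewrite ImM.
  by apply: diff_atD; apply: diff_atM.
Qed.

Lemma diffC_at_conj z : diffC_at z -> diffC_at (fun q => (z q)^*).
Proof.
move=> [rz iz]; split; first by under eq_fun do rewrite Reconj.
by under eq_fun do rewrite Imconj; exact: diff_atN.
Qed.

Lemma diffC_at_sum n (z : 'I_n -> pt M -> R[i]) :
  (forall i, diffC_at (z i)) -> diffC_at (fun q => \sum_i z i q).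
Proof.
move=> dz; split.
- under eq_fun do rewrite (big_morph _ ReD (erefl : complex.Re 0 = 0)).
  by apply: diff_at_sum => i; have [] := dz i.
- under eq_fun do rewrite (big_morph _ ImD (erefl : complex.Im 0 = 0)).
  by apply: diff_at_sum => i; have [] := dz i.
Qed.

Lemma ddC_cst v (c : R[i]) : ddC a v (fun=> c) p = 0.
Proof. by rewrite /ddC !dd_cst. Qed.

Lemma ddC_real v f : ddC a v (fun q => (f q)%:C) p = (dd a v f p)%:C.
Proof. by rewrite /ddC /= dd_cst. Qed.

Lemma ddC_conj v z : diffC_at z ->
  ddC a v (fun q => (z q)^*) p = (ddC a v z p)^*.
Proof.
move=> [rz iz]; rewrite /ddC /= -ddN//.
by congr (_ +i* _); congr (dd _ _ _ _); apply/funext => q; case: (z q).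
Qed.

Lemma ddC_sum v n (z : 'I_n -> pt M -> R[i]) : (forall i, diffC_at (z i)) ->
  ddC a v (fun q => \sum_i z i q) p = \sum_i ddC a v (z i) p.
Proof.
move=> dz; apply/eqP; rewrite eq_complex; apply/andP; split; apply/eqP => /=.
- rewrite (big_morph _ ReD (erefl : complex.Re 0 = 0)) /=.
  rewrite -dd_sum => [|i]; last by have [] := dz i.
  by congr (dd _ _ _ _); apply/funext => q;
    rewrite (big_morph _ ReD (erefl : complex.Re 0 = 0)).
- rewrite (big_morph _ ImD (erefl : complex.Im 0 = 0)) /=.
  rewrite -dd_sum => [|i]; last by have [] := dz i.
  by congr (dd _ _ _ _); apply/funext => q;
    rewrite (big_morph _ ImD (erefl : complex.Im 0 = 0)).
Qed.

Lemma ddCP (c : R) v w z : diffC_at z ->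
  ddC a (c *: v + w) z p = c%:C * ddC a v z p + ddC a w z p.
Proof.
move=> [rz iz]; rewrite /ddC !ddP//.
by apply/eqP; rewrite eq_complex /= !mul0r !(subr0, addr0) !eqxx.
Qed.

Lemma ddCM v z1 z2 : diffC_at z1 -> diffC_at z2 ->
  ddC a v (fun q => z1 q * z2 q) p
  = ddC a v z1 p * z2 p + z1 p * ddC a v z2 p.
Proof.
move=> [r1 i1] [r2 i2]; rewrite /ddC.
rewrite (_ : (fun q => complex.Re (z1 q * z2 q)) = fun q =>
  complex.Re (z1 q) * complex.Re (z2 q)
  + - (complex.Im (z1 q) * complex.Im (z2 q))); last first.
  by apply/funext => q; rewrite ReM.
rewrite (_ : (fun q => complex.Im (z1 q * z2 q)) = fun q =>
  complex.Re (z1 q) * complex.Im (z2 q)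
  + complex.Im (z1 q) * complex.Re (z2 q)); last first.
  by apply/funext => q; rewrite ImM.
rewrite !ddD ?ddN ?ddM //; do ?[exact: diff_atM | exact/diff_atN/diff_atM].
case: (z1 p) (z2 p) => [x1 y1] [x2 y2] /=.
by apply/eqP; rewrite eq_complex /=; apply/andP; split; apply/eqP; ring.
Qed.

End DirectionalDerivative.

Section MetricCompatibility.
Variables (R : realType) (M : riemannianSurface R) (a : atlas M) (p : pt M).
Hypothesis ap : chart_dom a p.
Implicit Types (u v w : 'rV[R]_2) (X Y : pt M -> 'rV[R]_2).

Lemma metricE q u w :
  metric a q u w = \sum_(k < 2) \sum_(l < 2) u 0 k * gram a q k l * w 0 l.
Proof.
rewrite /metric mxE exchange_big; apply: eq_bigr => l _ /=.
by rewrite mxE mulr_suml; apply: eq_bigr => k _; rewrite mxE.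
Qed.

Lemma gram_symE q (k l : 'I_2) : chart_dom a q -> gram a q k l = gram a q l k.
Proof. by move=> aq; rewrite -[in LHS](gram_sym aq) mxE. Qed.

Lemma metricC u w : metric a p u w = metric a p w u.
Proof.
rewrite /metric; suff -> : w *m gram a p *m u^T = (u *m gram a p *m w^T)^T.
  by rewrite [RHS]mxE.
by rewrite !trmx_mul trmxK (gram_sym ap) mulmxA.
Qed.

Lemma metricPl (c : R) u v w :
  metric a p (c *: u + v) w = c * metric a p u w + metric a p v w.
Proof. by rewrite /metric !mulmxDl -!scalemxAl mxE [X in X + _]mxE. Qed.

Lemma metricPr (c : R) u v w :
  metric a p w (c *: u + v) = c * metric a p w u + metric a p w v.
Proof. by rewrite metricC metricPl !(metricC w). Qed.

Lemma gram_unitmx : gram a p \in unitmx.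
Proof.
rewrite unitmxE unitfE; apply/det0P => -[v v0 vg].
by have := gram_posdef ap v0; rewrite vg mul0mx mxE ltxx.
Qed.

Lemma diff_at_gram (k l : 'I_2) : diff_at a p (fun q => gram a q k l).
Proof. exact: smoothM_diff_at (gram_smooth a k l) ap. Qed.

Definition diffv_at X : Prop := forall k, diff_at a p (fun q => X q 0 k).

Lemma dd_gram v (k l : 'I_2) : dd a v (fun q => gram a q k l) p =
  \sum_(n < 2) v 0 n * dd a (coord_vec R n) (fun q => gram a q k l) p.
Proof.
have d := diff_at_gram k l.
rewrite /dd deriveE// {1}(row_sum_delta v) linear_sum; apply: eq_bigr => n _.
by rewrite linearZ deriveE.
Qed.

Definition christoffel1 (k m n : 'I_2) : R :=
  2^-1 * (dd a (coord_vec R k) (fun q => gram a q m n) p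
          + dd a (coord_vec R m) (fun q => gram a q k n) p
          - dd a (coord_vec R n) (fun q => gram a q k m) p).

Lemma christoffel_lower (k m j : 'I_2) :
  \sum_l christoffel a p k m l * gram a p l j = christoffel1 k m j.
Proof.
pose c : 'rV[R]_2 := \row_n christoffel1 k m n.
have cE : \row_l christoffel a p k m l = c *m invmx (gram a p).
  apply/rowP => l; rewrite !mxE /christoffel mulr_sumr; apply: eq_bigr => n _.
  rewrite -[in LHS](gram_sym ap) -trmx_inv !mxE /christoffel1; ring.
have := congr1 (fun u => (u *m gram a p) 0 j) cE.
rewrite mulmxKV ?gram_unitmx// !mxE => <-.
by apply: eq_bigr => l _; rewrite mxE.
Qed.

Lemma metric_nabla v X w : metric a p (nabla a v X p) w =
  \sum_(k < 2) \sum_(l < 2) dd a v (fun q => X q 0 k) p * gram a p k l * w 0 l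
  + \sum_(k < 2) \sum_(m < 2) \sum_(j < 2)
      christoffel1 k m j * v 0 k * X p 0 m * w 0 j.
Proof.
rewrite metricE.
under eq_bigr do under eq_bigr do rewrite mxE.
under [X in _ = _ + X]eq_bigr do under eq_bigr do under eq_bigr do
  rewrite -christoffel_lower.
rewrite !(big_ord_recl, big_ord0) /=; ring.
Qed.

Lemma dd_metric v X Y : diffv_at X -> diffv_at Y ->
  dd a v (fun q => metric a q (X q) (Y q)) p
  = metric a p (nabla a v X p) (Y p) + metric a p (X p) (nabla a v Y p).
Proof.
move=> dX dY; rewrite (metricC (X p)) !metric_nabla.
under eq_fun do rewrite metricE.
have dXg k l : diff_at a p (fun q => X q 0 k * gram a q k l).
  by apply: diff_atM => //; exact: diff_at_gram.
rewrite dd_sum; last by move=> k; apply: diff_at_sum => l; apply: diff_atM.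
under eq_bigr => k _.
  rewrite dd_sum; last by move=> l; apply: diff_atM.
  under eq_bigr => l _.
    rewrite ddM// ddM//; last exact: diff_at_gram.
    rewrite dd_gram.
    over.
  over.
have s v' k l : dd a v' (fun q => gram a q k l) p = dd a v' (fun q => gram a q l k) p.
  by apply: dd_eq => // q; rewrite inE; exact: gram_symE.
rewrite /christoffel1 !(big_ord_recl, big_ord0) /=.
set i0 := ord0; set i1 := lift ord0 ord0.
rewrite !(s _ i1 i0) !(gram_symE i1 i0 ap).
move: (dd a v _ p) (dd a v _ p) (dd a v _ p) (dd a v _ p)
  (dd a _ (fun q => gram a q i0 i0) p) (dd a _ (fun q => gram a q i0 i1) p)
  (dd a _ (fun q => gram a q i1 i1) p) (dd a _ (fun q => gram a q i0 i0) p)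
  (dd a _ (fun q => gram a q i0 i1) p) (dd a _ (fun q => gram a q i1 i1) p)
  (X p 0 i0) (X p 0 i1) (Y p 0 i0) (Y p 0 i1) (v 0 i0) (v 0 i1)
  (gram a p i0 i0) (gram a p i0 i1) (gram a p i1 i1).
by move=> *; field.
Qed.

End MetricCompatibility.

Section Frames.
Variables (R : realType) (M : riemannianSurface R) (a : atlas M) (p : pt M).
Hypothesis ap : chart_dom a p.
Implicit Types (u v w : 'rV[R]_2) (X : pt M -> 'rV[R]_2) (F E : 'M[R]_2).

Definition bilinC (B : 'rV[R]_2 -> 'rV[R]_2 -> R[i]) : Prop :=
  (forall c u v w, B (c *: u + v) w = c%:C * B u w + B v w) /\
  (forall c u v w, B w (c *: u + v) = c%:C * B w u + B w v).

Lemma bilinC_coordE B u w : bilinC B -> B u w =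
  \sum_(k < 2) \sum_(l < 2)
    (u 0 k * w 0 l)%:C * B (coord_vec R k) (coord_vec R l).
Proof.
move=> [Bl Br].
have B0l w' : B 0 w' = 0.
  by have := Bl (-1) 0 0 w'; rewrite scaler0 addr0 rmorphN1 mulN1r addNr.
have B0r w' : B w' 0 = 0.
  by have := Br (-1) 0 0 w'; rewrite scaler0 addr0 rmorphN1 mulN1r addNr.
rewrite {1}(row_sum_delta u) {1}(row_sum_delta w) /coord_vec.
rewrite !(big_ord_recl, big_ord0) /= !Bl !Br !B0l !B0r !rmorphM /=; ring.
Qed.

Definition orthonormal_at F : Prop := forall k l : 'I_2,
  metric a p (row k F) (row l F) = (k == l)%:R.

Lemma orthonormal_atE F : orthonormal_at F -> F^T *m F = invmx (gram a p).
Proof.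
move=> oF.
have FgF : F *m (gram a p *m F^T) = 1%:M.
  apply/matrixP => k l; rewrite [RHS]mxE -oF /metric mulmxA !mxE.
  apply: eq_bigr => j _; rewrite !mxE; congr (_ * _).
  by apply: eq_bigr => n _; rewrite !mxE.
have := mulmx1C FgF; rewrite -mulmxA => gFF.
by rewrite -[LHS](mulKmx (gram_unitmx ap)) gFF mulmx1.
Qed.

(* Both traces contract [B] with the inverse metric. *)
Lemma orthonormal_trace B F E : bilinC B -> orthonormal_at F -> orthonormal_at E ->
  \sum_(k < 2) B (row k F) (row k F) = \sum_(k < 2) B (row k E) (row k E).
Proof.
move=> bB oF oE.
have tr G : \sum_(k < 2) B (row k G) (row k G) =
    \sum_(m < 2) \sum_(l < 2)
      ((G^T *m G) m l)%:C * B (coord_vec R m) (coord_vec R l).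
  under eq_bigr do rewrite bilinC_coordE//.
  rewrite exchange_big; apply: eq_bigr => m _ /=.
  rewrite exchange_big; apply: eq_bigr => l _ /=.
  by rewrite -mulr_suml mxE rmorph_sum; congr (_ * _);
    apply: eq_bigr => k _; rewrite !mxE.
by rewrite !tr !orthonormal_atE.
Qed.

Lemma nablaPl (c : R) u v X : diffv_at a p X ->
  nabla a (c *: u + v) X p = c *: nabla a u X p + nabla a v X p.
Proof.
move=> dX; apply/rowP => l; rewrite !mxE ddP// mulrDr addrACA; congr (_ + _).
rewrite mulr_sumr -big_split; apply: eq_bigr => k _ /=.
rewrite mulr_sumr -big_split; apply: eq_bigr => m _ /=.
rewrite !mxE; ring.
Qed.

Lemma diff_at_metric X Y : diffv_at a p X -> diffv_at a p Y ->
  diff_at a p (fun q => metric a q (X q) (Y q)).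
Proof.
move=> dX dY; under eq_fun do rewrite metricE.
apply: diff_at_sum => k; apply: diff_at_sum => l.
by apply: diff_atM => //; apply: diff_atM => //; exact: diff_at_gram.
Qed.

Lemma diffv_at_frame (W : set (pt M)) (F : pt M -> 'M[R]_2) k :
  local_orthonormal_frame a W F -> W p -> diffv_at a p (frame_vec F k).
Proof.
move=> [_ _ sF _] Wp l; rewrite /frame_vec.
by under eq_fun do rewrite mxE; apply: smoothM_diff_at Wp; exact: sF.
Qed.

Lemma nabla_frame_skew v (F : pt M -> 'M[R]_2) (k l : 'I_2) :
  local_orthonormal_frame a (chart_dom a) F ->
  metric a p (frame_vec F k p) (nabla a v (frame_vec F l) p)
  = - metric a p (nabla a v (frame_vec F k) p) (frame_vec F l p).
Proof.
move=> oF; have dF j : diffv_at a p (frame_vec F j) by exact: diffv_at_frame ap.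
apply/eqP; rewrite -addr_eq0 addrC -dd_metric//.
have [_ _ _ oFE] := oF.
rewrite (dd_eq ap _ (g := fun=> (k == l)%:R)) ?dd_cst// => q.
by rewrite inE => aq; exact: oFE.
Qed.

End Frames.

Section Herm.
Variable R : realType.
Implicit Types (u v w : 'cV[R[i]]_2) (c : R[i]).

Lemma conj_realC (x : R) : (x%:C)^*%R = x%:C :> R[i].
Proof. exact: conjc_real. Qed.

Lemma hermDl u v w : herm (u + v) w = herm u w + herm v w.
Proof. by rewrite /herm -big_split; apply: eq_bigr => k _; rewrite mxE mulrDl. Qed.

Lemma hermDr u v w : herm w (u + v) = herm w u + herm w v.
Proof.
by rewrite /herm -big_split; apply: eq_bigr => k _; rewrite mxE rmorphD mulrDr.
Qed.

Lemma hermZl c u w : herm (c *: u) w = c * herm u w.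
Proof. by rewrite /herm mulr_sumr; apply: eq_bigr => k _; rewrite mxE mulrA. Qed.

Lemma hermZr c u w : herm w (c *: u) = c^* * herm w u.
Proof.
by rewrite /herm mulr_sumr; apply: eq_bigr => k _; rewrite mxE rmorphM mulrCA.
Qed.

Lemma hermNl u w : herm (- u) w = - herm u w.
Proof. by rewrite -scaleN1r hermZl mulN1r. Qed.

Lemma hermNr u w : herm w (- u) = - herm w u.
Proof. by rewrite -scaleN1r hermZr rmorphN1 mulN1r. Qed.

Lemma herm_conj u w : (herm u w)^*%R = herm w u.
Proof.
rewrite /herm rmorph_sum; apply: eq_bigr => k _ /=.
by rewrite rmorphM /= conjCK mulrC.
Qed.

Lemma gamma_sq al : gamma_mx R al *m gamma_mx R al = - 1%:M.
Proof.
have two0 : (2 : R[i]) != 0 by rewrite pnatr_eq0.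
apply: (scalerI two0); rewrite scaler_nat mulr2n gamma_clifford eqxx mulr1.
by rewrite scalerN scalemx1 raddfN.
Qed.

Lemma gamma_anticomm :
  gamma_mx R 1 *m gamma_mx R 0 = - (gamma_mx R 0 *m gamma_mx R 1).
Proof.
by apply/eqP; rewrite -addr_eq0 gamma_clifford mulr0 -scalemx1 scale0r.
Qed.

Lemma herm_gamma01 u v : herm u (gamma_mx R 0 *m gamma_mx R 1 *m v)
  = - herm (gamma_mx R 0 *m gamma_mx R 1 *m u) v.
Proof.
rewrite -hermNl -mulNmx -gamma_anticomm -!mulmxA !herm_gamma.
by rewrite opprK.
Qed.

Lemma herm_skew_comm (A C : 'M[R[i]]_2) u w :
  (forall v, herm u (A *m v) = - herm (A *m u) v) ->
  herm (A *m u) (C *m w) + herm u (C *m (A *m w))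
  = herm u ((C *m A - A *m C) *m w).
Proof.
move=> skewA; rewrite mulmxBl hermDr hermNr addrC !mulmxA; congr (_ + _).
by rewrite -mulmxA skewA opprK.
Qed.

Lemma gamma_comm0 :
  gamma_mx R 0 *m (gamma_mx R 0 *m gamma_mx R 1)
  - gamma_mx R 0 *m gamma_mx R 1 *m gamma_mx R 0 = - 2 *: gamma_mx R 1.
Proof.
rewrite -[in X in _ - X]mulmxA gamma_anticomm mulmxN opprK mulmxA gamma_sq.
by rewrite mulNmx mul1mx scaleNr scaler_nat mulr2n opprD.
Qed.

Lemma gamma_comm1 :
  gamma_mx R 1 *m (gamma_mx R 0 *m gamma_mx R 1)
  - gamma_mx R 0 *m gamma_mx R 1 *m gamma_mx R 1 = 2 *: gamma_mx R 0.
Proof.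
rewrite mulmxA gamma_anticomm mulNmx -!mulmxA gamma_sq mulmxN mulmx1 opprK.
by rewrite scaler_nat mulr2n.
Qed.

End Herm.

Section SpinorCalculus.
Variables (R : realType) (M : closedSurface R) (a : atlas M) (p : pt M).
Hypothesis ap : chart_dom a p.
Implicit Types (v : 'rV[R]_2) (u w : pt M -> 'cV[R[i]]_2).

Definition diffs_at u : Prop := forall k, diffC_at a p (fun q => u q k 0).

Definition dcol v u : 'cV[R[i]]_2 := \col_k ddC a v (fun q => u q k 0) p.

Lemma diffs_at_mulmx (A : 'M[R[i]]_2) u :
  diffs_at u -> diffs_at (fun q => A *m u q).
Proof.
move=> du k; under eq_fun do rewrite mxE.
by apply: diffC_at_sum => j; apply: diffC_atM => //; exact: diffC_at_cst.
Qed.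

Lemma dcol_mulmx (A : 'M[R[i]]_2) v u :
  diffs_at u -> dcol v (fun q => A *m u q) = A *m dcol v u.
Proof.
move=> du; apply/colP => k; rewrite !mxE.
under eq_fun do rewrite mxE.
have dA j : diffC_at a p (fun=> A k j) by exact: diffC_at_cst.
rewrite ddC_sum; last by move=> j; exact: diffC_atM.
by apply: eq_bigr => j _; rewrite ddCM// ddC_cst mul0r add0r mxE.
Qed.

Lemma diffC_at_herm u w : diffs_at u -> diffs_at w ->
  diffC_at a p (fun q => herm (u q) (w q)).
Proof.
by move=> du dw; apply: diffC_at_sum => k; apply: diffC_atM => //; exact: diffC_at_conj.
Qed.

Lemma ddC_herm v u w : diffs_at u -> diffs_at w ->
  ddC a v (fun q => herm (u q) (w q)) p
  = herm (dcol v u) (w p) + herm (u p) (dcol v w).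
Proof.
move=> du dw; have dw' k : diffC_at a p (fun q => (w q k 0)^*).
  exact: diffC_at_conj.
rewrite ddC_sum; last by move=> k; apply: diffC_atM; [exact: du|exact: dw'].
rewrite -big_split; apply: eq_bigr => k _.
rewrite ddCM//; last exact: dw'.
by rewrite (ddC_conj _ (dw k)) !mxE.
Qed.

End SpinorCalculus.

Section Current.
Variables (R : realType) (S : spinSurface R) (a : atlas S) (p : pt S).
Hypothesis ap : chart_dom a p.
Local Notation E := (frame_vec (onframe a)).

Definition conn1 (v : 'rV[R]_2) : R := metric a p (nabla a v (E 0) p) (E 1 p).

Lemma clif_onframe al : clif a p (E al p) = gamma_mx R al.
Proof.
have [_ _ _ oE] := onframe_orthonormal a.
rewrite /clif /clif_frame (bigD1 al)//= big1 ?addr0 => [|be neq].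
  by rewrite oE// eqxx scale1r.
by rewrite oE// eq_sym (negbTE neq) scale0r.
Qed.

Lemma diffs_at_spinor (psi : spinor S) : smooth_spinor psi -> diffs_at a p (psi a).
Proof.
by move=> [spsi _] k; have [re im] := spsi a k; split;
  [apply: smoothM_diff_at re ap|apply: smoothM_diff_at im ap].
Qed.

Lemma diffv_at_onframe al : diffv_at a p (E al).
Proof. exact: diffv_at_frame (onframe_orthonormal a) ap. Qed.

Lemma dcol_nabla_spin v (psi : spinor S) : dcol a p v (psi a) =
  nabla_spin a v psi p
  - (2^-1 * conn1 v)%:C *: (gamma_mx R 0 *m gamma_mx R 1 *m psi a p).
Proof. by rewrite /nabla_spin -/(conn1 v) addrK. Qed.

Definition current_coef (phi psi : spinor S) (al : 'I_2) q : R[i] :=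
  herm (phi a q) (gamma_mx R al *m psi a q).

Lemma diffC_at_current_coef phi psi al : smooth_spinor phi -> smooth_spinor psi ->
  diffC_at a p (current_coef phi psi al).
Proof.
move=> sphi spsi; apply: diffC_at_herm; first exact: diffs_at_spinor.
by apply: diffs_at_mulmx; exact: diffs_at_spinor.
Qed.

Lemma ddC_current_coef v phi psi al : smooth_spinor phi -> smooth_spinor psi ->
  ddC a v (current_coef phi psi al) p
  = herm (nabla_spin a v phi p) (gamma_mx R al *m psi a p)
    + herm (phi a p) (gamma_mx R al *m nabla_spin a v psi p)
    - (2^-1 * conn1 v)%:C
      * herm (phi a p)
          ((gamma_mx R al *m (gamma_mx R 0 *m gamma_mx R 1)
            - gamma_mx R 0 *m gamma_mx R 1 *m gamma_mx R al) *m psi a p).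
Proof.
move=> sphi spsi.
have dphi := diffs_at_spinor sphi; have dpsi := diffs_at_spinor spsi.
rewrite ddC_herm//; last exact: diffs_at_mulmx.
rewrite dcol_mulmx// !dcol_nabla_spin -herm_skew_comm; last first.
  exact: herm_gamma01.
move: (gamma_mx R 0 *m gamma_mx R 1) (gamma_mx R al) => A C.
rewrite mulmxBr -scalemxAr hermDl hermNl hermDr hermNr hermZl hermZr conj_realC.
ring.
Qed.

Lemma noether_currentE q (psi : 'I_q -> spinor S) i m X x :
  noether_current psi i m a X x = \sum_(al < 2)
    (metric a x (X x) (E al x))%:C * current_coef (psi i) (psi m) al x.
Proof.
rewrite /noether_current /clif /clif_frame mulmx_suml.
have h0 : herm (psi i a x) 0 = 0.
  by have := hermZr 0 0 (psi i a x); rewrite scaler0 rmorph0 mul0r.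
rewrite (big_morph _ (fun u v => hermDr u v _) h0).
by apply: eq_bigr => al _; rewrite -scalemxAl hermZr conj_realC.
Qed.

Definition nabla_current phi psi (u w : 'rV[R]_2) : R[i] := \sum_(al < 2)
  ((metric a p w (nabla a u (E al) p))%:C * current_coef phi psi al p
   + (metric a p w (E al p))%:C * ddC a u (current_coef phi psi al) p).

Lemma bilinC_nabla_current phi psi : smooth_spinor phi -> smooth_spinor psi ->
  bilinC (nabla_current phi psi).
Proof.
move=> sphi spsi; split=> c u v w; rewrite /nabla_current mulr_sumr -big_split;
  apply: eq_bigr => al _ /=.
- rewrite nablaPl; last exact: diffv_at_onframe.
  rewrite ddCP; last exact: diffC_at_current_coef.
  rewrite metricPr// rmorphD rmorphM /=.
  move: (ddC _ _ _ _) (ddC _ _ _ _) (current_coef _ _ _ _) (_%:C) (_%:C) (_%:C) (_%:C).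
  by move=> *; ring.
- rewrite !metricPl !rmorphD !rmorphM /=.
  move: (ddC _ _ _ _) (current_coef _ _ _ _) (_%:C) (_%:C) (_%:C) (_%:C) (_%:C).
  by move=> *; ring.
Qed.

Lemma nabla_form_noether q (psi : 'I_q -> spinor S) i m X Y :
  smooth_spinor (psi i) -> smooth_spinor (psi m) -> diffv_at a p Y ->
  nabla_form a X (noether_current psi i m a) Y p
  = nabla_current (psi i) (psi m) (X p) (Y p).
Proof.
move=> si sm dY; rewrite /nabla_form noether_currentE.
rewrite (_ : noether_current psi i m a Y = fun x => \sum_(al < 2)
    (metric a x (Y x) (E al x))%:C * current_coef (psi i) (psi m) al x); last first.
  by apply/funext => x; exact: noether_currentE.
have dm al : diffC_at a p (fun x => (metric a x (Y x) (E al x))%:C).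
  by apply: diffC_at_real; apply: diff_at_metric => //; exact: diffv_at_onframe.
have dc al := diffC_at_current_coef al si sm.
rewrite ddC_sum; last by move=> al; exact: diffC_atM.
rewrite -sumrB; apply: eq_bigr => al _.
rewrite ddCM// ddC_real dd_metric//; last exact: diffv_at_onframe.
rewrite rmorphD /=.
move: (ddC _ _ _ _) (current_coef _ _ _ _) (_%:C) (_%:C) (_%:C).
by move=> *; ring.
Qed.

Lemma metric_nabla_onframe v al : metric a p (E al p) (nabla a v (E al) p) = 0.
Proof.
have := nabla_frame_skew ap v al al (onframe_orthonormal a).
by rewrite [in RHS]metricC// => /eqP; rewrite -addr_eq0 -mulr2n mulrn_eq0 => /eqP.
Qed.

Lemma sum_ord2 (V : nmodType) (f : 'I_2 -> V) : \sum_(k < 2) f k = f 0 + f 1.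
Proof.
by rewrite !big_ord_recl big_ord0 addr0; congr (f _ + f _); exact: val_inj.
Qed.

Lemma dirac_opE (psi : spinor S) : dirac_op a psi p =
  gamma_mx R 0 *m nabla_spin a (E 0 p) psi p
  + gamma_mx R 1 *m nabla_spin a (E 1 p) psi p.
Proof. by rewrite /dirac_op sum_ord2 !clif_onframe. Qed.

Lemma ddC_current_coef0 v phi psi : smooth_spinor phi -> smooth_spinor psi ->
  ddC a v (current_coef phi psi 0) p
  = herm (phi a p) (gamma_mx R 0 *m nabla_spin a v psi p)
    - herm (gamma_mx R 0 *m nabla_spin a v phi p) (psi a p)
    + (conn1 v)%:C * current_coef phi psi 1 p.
Proof.
move=> sphi spsi; rewrite (ddC_current_coef v 0 sphi spsi) gamma_comm0 herm_gamma.
rewrite [- _ + _]addrC; congr (_ + _).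
rewrite -scalemxAl hermZr rmorphN rmorph_nat mulrA -mulNr; congr (_ * _).
rewrite rmorphM fmorphV rmorph_nat /=.
by field.
Qed.

Lemma ddC_current_coef1 v phi psi : smooth_spinor phi -> smooth_spinor psi ->
  ddC a v (current_coef phi psi 1) p
  = herm (phi a p) (gamma_mx R 1 *m nabla_spin a v psi p)
    - herm (gamma_mx R 1 *m nabla_spin a v phi p) (psi a p)
    - (conn1 v)%:C * current_coef phi psi 0 p.
Proof.
move=> sphi spsi; rewrite (ddC_current_coef v 1 sphi spsi) gamma_comm1 herm_gamma.
rewrite [- _ + _]addrC; congr (_ - _).
rewrite -scalemxAl hermZr rmorph_nat mulrA; congr (_ * _).
rewrite rmorphM fmorphV rmorph_nat /=.
by field.
Qed.

Lemma nabla_current_trace phi psi : smooth_spinor phi -> smooth_spinor psi ->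
  \sum_(be < 2) nabla_current phi psi (E be p) (E be p)
  = herm (phi a p) (dirac_op a psi p) - herm (dirac_op a phi p) (psi a p).
Proof.
move=> sphi spsi; have [_ _ _ oE] := onframe_orthonormal a.
pose N be al := metric a p (E be p) (nabla a (E be p) (E al) p).
pose H be al := metric a p (E be p) (E al p).
pose G al := current_coef phi psi al p.
pose D be al := ddC a (E be p) (current_coef phi psi al) p.
have -> : \sum_(be < 2) nabla_current phi psi (E be p) (E be p) =
    \sum_(be < 2) \sum_(al < 2) ((N be al)%:C * G al + (H be al)%:C * D be al).
  by [].
have HE be al : H be al = (be == al)%:R by exact: oE.
have N00 : N 0 0 = 0 by exact: metric_nabla_onframe.
have N11 : N 1 1 = 0 by exact: metric_nabla_onframe.
have N01 : N 0 1 = - conn1 (E 0 p).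
  exact: (nabla_frame_skew ap (E 0 p) 0 1 (onframe_orthonormal a)).
have N10 : N 1 0 = conn1 (E 1 p) by exact: metricC.
pose P al := herm (phi a p) (gamma_mx R al *m nabla_spin a (E al p) psi p).
pose Q al := herm (gamma_mx R al *m nabla_spin a (E al p) phi p) (psi a p).
have PE : herm (phi a p) (dirac_op a psi p) = P 0 + P 1.
  by rewrite dirac_opE hermDr.
have QE : herm (dirac_op a phi p) (psi a p) = Q 0 + Q 1.
  by rewrite dirac_opE hermDl.
have D00 : D 0 0 = P 0 - Q 0 + (conn1 (E 0 p))%:C * G 1.
  exact: ddC_current_coef0.
have D11 : D 1 1 = P 1 - Q 1 - (conn1 (E 1 p))%:C * G 0.
  exact: ddC_current_coef1.
rewrite PE QE.
clearbody N H G D P Q.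
rewrite !sum_ord2 N00 N11 N01 N10 !HE /= D00 D11 rmorphN /=; ring.
Qed.

End Current.

Theorem lemma3p17 (R : realType) (S : spinSurface R) (lambda kappa : R)
    (q : nat) (psi : 'I_q -> spinor S)
    (psi_smooth : forall j : 'I_q, smooth_spinor (psi j))
    (psi_sol : nonlinear_dirac lambda kappa psi)
    (i m : 'I_q) (a : atlas S) (W : set (pt S))
    (F : pt S -> 'M[R]_2) (F_frame : local_orthonormal_frame a W F)
    (p : pt S) (Wp : W p) :
  divergence a F (noether_current psi i m a) p = 0%R.
Proof.
have [_ Wa _ oF] := F_frame; have ap := Wa _ Wp.
have [_ _ _ oE] := onframe_orthonormal a.
rewrite /divergence.
under eq_bigr => al _.
  rewrite nabla_form_noether//; last exact: diffv_at_frame F_frame Wp.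
  over.
have bB := bilinC_nabla_current ap (psi_smooth i) (psi_smooth m).
rewrite /= (orthonormal_trace ap bB (E := onframe a p)); last 2 first.
- by move=> k l; exact: oF.
- by move=> k l; exact: oE.
rewrite nabla_current_trace// !psi_sol// -!scalerDl hermZr hermZl.
have -> : (lambda%:C + kappa%:C * sqnorm psi a p)^*%R
  = lambda%:C + kappa%:C * sqnorm psi a p.
  rewrite rmorphD rmorphM /= !conj_realC /sqnorm rmorph_sum.
  by under eq_bigr do rewrite /= herm_conj.
by rewrite subrr.
Qed.
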